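(* Assume CH and that there exists a Canary tree. Then there is \(\Phi\in PC(L_{\omega_2\omega_1})\) such that for all \(A\subseteq\omega_1\): \(\langle\omega_1,<,A\rangle\models\Phi\) if and only if \(A\) is stationary in \(\omega_1\).
   Context: A Canary tree is a tree \(\mathcal{C}\) of cardinality \(\le 2^{\omega}\) with no uncountable branches such that whenever a stationary subset of \(\omega_1\) is made non-stationary by a forcing which does not add new reals, this forcing adds an uncountable branch to \(\mathcal{C}\). \(L_{\omega_2\omega_1}\) is the infinitary logic with conjunctions/disjunctions of fewer than \(\omega_2\) formulas and quantification over countable blocks of variables. A class of \(\{<,A\}\)-structures is \(PC(L_{\omega_2\omega_1})\)-definable (is of the form \(\mathrm{Mod}(\Phi)\) for some \(\Phi\in PC(L_{\omega_2\omega_1})\)) if there is a sentence \(\Psi\) of \(L_{\omega_2\omega_1}\) in an expanded vocabulary, containing additional relation symbols (here allowed to have \(\omega\)-sequences of argument places), such that a structure belongs to the class iff it has an expansion to the expanded vocabulary satisfying \(\Psi\). \(<\) denotes the usual ordinal order on \(\omega_1\). *)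

(* Defs.v *)
From mathcomp Require Import all_boot all_classical.

Set Implicit Arguments.
Unset Strict Implicit.
Unset Printing Implicit Defensive.

Local Open Scope classical_set_scope.
Local Open Scope card_scope.

(** * Orders, [omega_1], stationary sets *)

Definition comparable_by (T : Type) (lt : T -> T -> Prop) (x y : T) : Prop :=
  lt x y \/ x = y \/ lt y x.

Definition strict_order (T : Type) (lt : T -> T -> Prop) : Prop :=
  (forall x, ~ lt x x) /\ (forall x y z, lt x y -> lt y z -> lt x z).

(* For a strict order [lt]: its restriction to [A] is a well-order. *)
Definition well_ordered (T : Type) (lt : T -> T -> Prop) (A : set T) : Prop :=
  (forall x y, A x -> A y -> comparable_by lt x y) /\
  (forall B : set T, B `<=` A -> B !=set0 ->
     exists2 m, B m & forall x, B x -> x = m \/ lt m x).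

(* [(W, lt)] is a copy of the ordinal [omega_1]: an uncountable well-order all
   of whose proper initial segments are countable. *)
Definition is_omega1 (W : Type) (lt : W -> W -> Prop) : Prop :=
  [/\ strict_order lt,
      well_ordered lt [set: W],
      ~ countable [set: W]
    & forall x, countable [set y | lt y x]].

(* [2 ^ omega = omega_1], [W] being a copy of [omega_1]. *)
Definition CH (W : Type) : Prop := [set: set nat] #= [set: W].

Definition unbounded (W : Type) (lt : W -> W -> Prop) (C : set W) : Prop :=
  forall x, exists2 y, C y & lt x y.

(* The two premises on [d] say that [d] is a limit point of [C]; the first one
   excludes [d = 0]. *)
Definition closed_in (W : Type) (lt : W -> W -> Prop) (C : set W) : Prop :=
  forall d, (exists x, lt x d) ->
    (forall x, lt x d -> exists y, [/\ C y, lt x y & lt y d]) -> C d.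

Definition club (W : Type) (lt : W -> W -> Prop) (C : set W) : Prop :=
  unbounded lt C /\ closed_in lt C.

Definition stationary (W : Type) (lt : W -> W -> Prop) (S : set W) : Prop :=
  forall C, club lt C -> S `&` C !=set0.

(** * Trees and branches *)

Definition is_tree (T : Type) (lt : T -> T -> Prop) : Prop :=
  strict_order lt /\ forall t, well_ordered lt [set s | lt s t].

(* A branch is a maximal chain. *)
Definition branch (T : Type) (lt : T -> T -> Prop) (B : set T) : Prop :=
  (forall x y, B x -> B y -> comparable_by lt x y) /\
  (forall y, (forall x, B x -> comparable_by lt x y) -> B y).

(** * Forcing *)

(* [fle p q]: the condition [p] is stronger than [q]. *)
Record forcing := Forcing {
  cond :> Type;
  fle : cond -> cond -> Prop;
  fle_refl : forall p, fle p p;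
  fle_trans : forall p q r, fle p q -> fle q r -> fle p r;
  forcing_inhabited : exists p : cond, True }.

(* A statement of the forcing language over [P], identified with the set of
   conditions forcing it. The connectives below are the recursive clauses of
   the definition of the forcing relation. *)
Definition fstmt (P : forcing) : Type := P -> Prop.

Definition dense_below (P : forcing) (p : P) (D : set P) : Prop :=
  forall q, fle q p -> exists2 r, fle r q & D r.

(* An absolute statement about the ground model, of truth value [Q] there. *)
Definition fground (P : forcing) (Q : Prop) : fstmt P := fun _ => Q.

Definition fnot (P : forcing) (phi : fstmt P) : fstmt P :=
  fun p => forall q, fle q p -> ~ phi q.

Definition fand (P : forcing) (phi psi : fstmt P) : fstmt P :=
  fun p => phi p /\ psi p.

Definition fimp (P : forcing) (phi psi : fstmt P) : fstmt P :=
  fun p => forall q, fle q p -> phi q -> psi q.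

Definition fiff (P : forcing) (phi psi : fstmt P) : fstmt P :=
  fand (fimp phi psi) (fimp psi phi).

(* The index type [I] of the quantifiers is either a set of the ground model
   (quantification over the elements of a check-name) or a type of names
   (quantification over the subsets, in the generic extension, of a set of the
   ground model). *)
Definition fall (P : forcing) (I : Type) (phi : I -> fstmt P) : fstmt P :=
  fun p => forall i, phi i p.

Definition fex (P : forcing) (I : Type) (phi : I -> fstmt P) : fstmt P :=
  fun p => dense_below p (fun q => exists i, phi i q).

(* Forced by every condition, i.e. true in every generic extension. *)
Definition forced (P : forcing) (phi : fstmt P) : Prop := forall p, phi p.

(* A [P]-name for a subset of the ground model set [X]: a set of pairs
   (check-name of an element of [X], condition). Every subset of [X] in a
   generic extension has such a name. *)
Definition name (P : forcing) (X : Type) : Type := set (X * P).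

Definition fmem (P : forcing) (X : Type) (x : X) (tau : name P X) : fstmt P :=
  fun p => dense_below p (fun q => exists2 r, tau (x, r) & fle q r).

Arguments fground {P} Q.

Definition adds_no_reals (P : forcing) : Prop :=
  forced (fall (fun tau : name P nat =>
    fex (fun a : set nat =>
      fall (fun n : nat => fiff (fmem n tau) (fground (a n)))))).

Definition f_unbounded (P : forcing) (W : Type) (lt : W -> W -> Prop)
    (C : name P W) : fstmt P :=
  fall (fun x : W => fex (fun y : W => fand (fmem y C) (fground (lt x y)))).

Definition f_closed (P : forcing) (W : Type) (lt : W -> W -> Prop)
    (C : name P W) : fstmt P :=
  fall (fun d : W =>
    fimp (fground (exists x, lt x d))
      (fimp
        (fall (fun x : W => fimp (fground (lt x d))
           (fex (fun y : W => fand (fmem y C) (fground (lt x y /\ lt y d))))))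
        (fmem d C))).

Definition f_club (P : forcing) (W : Type) (lt : W -> W -> Prop)
    (C : name P W) : fstmt P :=
  fand (f_unbounded lt C) (f_closed lt C).

Definition f_stationary (P : forcing) (W : Type) (lt : W -> W -> Prop)
    (S : set W) : fstmt P :=
  fall (fun C : name P W =>
    fimp (f_club lt C)
      (fex (fun x : W => fand (fground (S x)) (fmem x C)))).

Definition makes_nonstationary (P : forcing) (W : Type) (lt : W -> W -> Prop)
    (S : set W) : Prop :=
  forced (fnot (@f_stationary P W lt S)).

(* In the extension there is an injective function from [B] to [omega]; [f] is
   a name for its graph. *)
Definition f_countable (P : forcing) (X : Type) (B : name P X) : fstmt P :=
  fex (fun f : name P (X * nat) =>
    fand
      (fall (fun x : X => fimp (fmem x B) (fex (fun n : nat => fmem (x, n) f))))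
    (fand
      (fall (fun x : X => fall (fun m : nat => fall (fun n : nat =>
         fimp (fand (fmem (x, m) f) (fmem (x, n) f)) (fground (m = n))))))
      (fall (fun x : X => fall (fun y : X => fall (fun n : nat =>
         fimp (fand (fmem (x, n) f) (fmem (y, n) f)) (fground (x = y)))))))).

Definition f_branch (P : forcing) (T : Type) (lt : T -> T -> Prop)
    (B : name P T) : fstmt P :=
  fand
    (fall (fun x : T => fall (fun y : T =>
       fimp (fand (fmem x B) (fmem y B)) (fground (comparable_by lt x y)))))
    (fall (fun y : T =>
       fimp
         (fall (fun x : T => fimp (fmem x B) (fground (comparable_by lt x y))))
         (fmem y B))).

Definition adds_uncountable_branch (P : forcing) (T : Type)
    (lt : T -> T -> Prop) : Prop :=
  forced (fex (fun B : name P T =>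
    fand (f_branch lt B) (fnot (f_countable B)))).

(* [ltW] is the order of [omega_1], [ltT] that of the tree. *)
Definition canary_tree (W : Type) (ltW : W -> W -> Prop)
    (T : Type) (ltT : T -> T -> Prop) : Prop :=
  [/\ is_tree ltT,
      [set: T] #<= [set: set nat],
      forall B : set T, branch ltT B -> countable B
    & forall (S : set W) (P : forcing),
        stationary ltW S -> adds_no_reals P -> makes_nonstationary P ltW S ->
        adds_uncountable_branch P ltT].

(** * The logic [L_{omega_2 omega_1}] *)

(* Arity [Some n] means [n] argument places, [None] an [omega]-sequence. *)
Definition places (a : option nat) : Type :=
  if a is Some n then 'I_n else nat.

Record vocabulary := Vocabulary {
  sym : Type;
  arity : sym -> option nat }.

Record structure (V : vocabulary) := Structure {
  dom : Type;
  interp : forall R : sym V, (places (arity R) -> dom) -> Prop }.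

(* Formulas with free variables in [X]. With [W] a copy of [omega_1],
   conjunctions and disjunctions of fewer than [omega_2] formulas are those
   indexed by types of cardinality at most that of [W]. A quantifier binds a
   block of fresh variables indexed by a countable type. *)
Inductive formula (W : Type) (V : vocabulary) (X : Type) : Type :=
| Feq of X & X
| Frel (R : sym V) of (places (arity R) -> X)
| Fnot of formula W V X
| Fconj (I : Type) of [set: I] #<= [set: W] & (I -> formula W V X)
| Fdisj (I : Type) of [set: I] #<= [set: W] & (I -> formula W V X)
| Fexists (I : Type) of countable [set: I] & formula W V (X + I)
| Fforall (I : Type) of countable [set: I] & formula W V (X + I).

Definition sentence (W : Type) (V : vocabulary) : Type := formula W V Empty_set.

Definition extend_env (X I D : Type) (a : X -> D) (b : I -> D) : X + I -> D :=
  fun v => match v with inl x => a x | inr i => b i end.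

Fixpoint sat (W : Type) (V : vocabulary) (M : structure V) (X : Type)
    (f : formula W V X) {struct f} : (X -> dom M) -> Prop :=
  match f with
  | Feq x y => fun a => a x = a y
  | Frel R t => fun a => @interp V M R (fun i => a (t i))
  | Fnot g => fun a => ~ @sat W V M _ g a
  | Fconj K _ g => fun a => forall i : K, @sat W V M _ (g i) a
  | Fdisj K _ g => fun a => exists i : K, @sat W V M _ (g i) a
  | Fexists K _ g => fun a => exists b : K -> dom M,
      @sat W V M _ g (extend_env a b)
  | Fforall K _ g => fun a => forall b : K -> dom M,
      @sat W V M _ g (extend_env a b)
  end.

Definition satisfies (W : Type) (V : vocabulary) (M : structure V)
    (f : sentence W V) : Prop :=
  @sat W V M _ f (fun e : Empty_set => match e with end).

(** * Projective classes *)

Definition expanded_vocabulary (V E : vocabulary) : vocabulary :=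
  @Vocabulary (sym V + sym E)%type
    (fun R => match R with inl R1 => arity R1 | inr R2 => arity R2 end).

Definition interp_on (E : vocabulary) (D : Type) : Type :=
  forall R : sym E, (places (arity R) -> D) -> Prop.

Definition expansion (V E : vocabulary) (M : structure V)
    (J : interp_on E (dom M)) : structure (expanded_vocabulary V E) :=
  @Structure (expanded_vocabulary V E) (dom M)
    (fun R => match R return
       (places (@arity (expanded_vocabulary V E) R) -> dom M) -> Prop with
     | inl R1 => @interp V M R1
     | inr R2 => J R2
     end).

Record PC (W : Type) (V : vocabulary) := MkPC {
  pc_extra : vocabulary;
  pc_sentence : sentence W (expanded_vocabulary V pc_extra) }.

Definition PC_models (W : Type) (V : vocabulary) (M : structure V)
    (Phi : PC W V) : Prop :=
  exists J : interp_on (pc_extra Phi) (dom M),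
    satisfies (expansion J) (pc_sentence Phi).

Inductive lt_pred_sym := Sym_lt | Sym_A.

Definition lt_pred_vocabulary : vocabulary :=
  Vocabulary (fun R => match R with Sym_lt => Some 2 | Sym_A => Some 1 end).

Definition lt_pred_structure (W : Type) (lt : W -> W -> Prop) (A : set W) :
    structure lt_pred_vocabulary :=
  @Structure lt_pred_vocabulary W
    (fun R => match R return (places (@arity lt_pred_vocabulary R) -> W) -> Prop
     with
     | Sym_lt => fun t => lt (t (@Ordinal 2 0 isT)) (t (@Ordinal 2 1 isT))
     | Sym_A => fun t => A (t (@Ordinal 1 0 isT))
     end).

(* Main.v *)
(** Call a closed subset of [omega_1] with a maximum that misses [A] a condition,
    and order conditions by end-extension. If [A] is stationary and contains no
    club, this forcing shoots a club through the complement of [A] without adding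
    reals, so it adds an uncountable branch [B] to the Canary tree [T]. Below
    some condition, the sets [o p] of all [t] such that [p] forces [t] to be in
    [B] are chains of [T], increase with [p], and can always be made to grow: if
    [o p] never grew below [p], it would be an uncountable branch of the ground
    model. Conversely, if a club [D] misses [A], then such a map [o] can be
    followed along [omega_1] many conditions whose maxima are in [D] (limits of
    them stay conditions), and this yields an uncountable branch of [T]. Hence
    [A] is stationary iff it contains a club or carries such a map [o]. The
    latter condition is [PC]: conditions are enumerated by [omega]-sequences, and
    by CH there are at most [omega_1] relations "[t] is in [o p]". *)

Require Import Defs.
From mathcomp Require Import all_boot all_classical.

Set Implicit Arguments.
Unset Strict Implicit.
Unset Printing Implicit Defensive.

Local Open Scope classical_set_scope.
Local Open Scope card_scope.

(** * Enumerations of countable sets, and branches through chains *)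

Lemma countable_range (X : Type) (B : set X) (x0 : X) :
  countable B -> B x0 -> exists c : nat -> X, range c = B.
Proof.
move=> /pfcard_geP[->//|[f]] Bx0; exists f.
apply/seteqP; split=> [_ [n _ <-]|x /(@surj _ _ _ _ f)[n _ <-]]; last by exists n.
exact: funS.
Qed.

(** Zorn's lemma is applied to the sets whose union with [C] is a chain, so that the union of the
    empty family qualifies as well. *)
Lemma chain_sub_branch (T : Type) (ltT : T -> T -> Prop) (C : set T) :
  (forall x y, C x -> C y -> comparable_by ltT x y) ->
  exists2 B, C `<=` B & branch ltT B.
Proof.
move=> chC.
pose chain (B : set T) := forall x y, (B `|` C) x -> (B `|` C) y ->
  comparable_by ltT x y.
have [F Fch Ftot|B [chB maxB]] := @Zorn_bigcup T chain.
  move=> x y [[X FX Xx]|Cx] [[Y FY Yy]|Cy].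
  - have [XY|YX] := Ftot _ _ FX FY.
      by apply: (Fch _ FY); left=> //; exact: XY.
    by apply: (Fch _ FX); left=> //; exact: YX.
  - by apply: (Fch _ FX); [left|right].
  - by apply: (Fch _ FY); [right|left].
  - exact: chC.
exists (B `|` C); first by move=> x; right.
split=> // y cmp; left; apply: contrapT => nBy.
apply: (maxB (B `|` [set y])).
  by split=> [x|/(_ y)]; [left|move=> /(_ (or_intror erefl))].
have csym x z : comparable_by ltT x z -> comparable_by ltT z x.
  by rewrite /comparable_by => -[|[->|]]; tauto.
move=> x z; rewrite -!setUA ![[set y] `|` C]setUC !setUA.
move=> [BCx|->] [BCz|->]; [exact: chB|exact: cmp|exact/csym/cmp|].
by right; left.
Qed.

(** * Countable suprema and clubs in [omega_1] *)

Section Omega1.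
Variables (W : Type) (lt : W -> W -> Prop) (omega1_W : is_omega1 lt).

Lemma omega1_irr x : ~ lt x x.
Proof. by have [[]] := omega1_W. Qed.

Lemma omega1_trans x y z : lt x y -> lt y z -> lt x z.
Proof. by have [[_]] := omega1_W => + _ _ _; exact. Qed.

Lemma omega1_asym x y : lt x y -> ~ lt y x.
Proof. by move=> xy yx; exact: omega1_irr (omega1_trans xy yx). Qed.

Lemma omega1_total x y : comparable_by lt x y.
Proof. by have [_ [+ _] _ _] := omega1_W; exact. Qed.

Lemma omega1_least (B : set W) : B !=set0 ->
  exists2 m, B m & forall x, B x -> x = m \/ lt m x.
Proof. by have [_ [_ +] _ _] := omega1_W; exact. Qed.

Lemma omega1_countable_le x : countable [set y | y = x \/ lt y x].
Proof.
have [_ _ _ /(_ x) cx] := omega1_W.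
rewrite (_ : mkset _ = \bigcup_(b in [set: bool])
    (if b then [set x] else [set y | lt y x])).
  by apply: bigcup_countable => // -[].
apply/seteqP; split=> [y [->|yx]|y [[] _]]; first by exists true.
- by exists false.
- by move=> ->; left.
- by right.
Qed.

Lemma omega1_infinite : [set: nat] #<= [set: W].
Proof.
by apply/infiniteP => /finite_set_countable; have [] := omega1_W.
Qed.

Lemma countable_bounded (X : set W) : countable X ->
  exists z, forall x, X x -> lt x z.
Proof.
move=> cX; apply: contrapT => nb; have [_ _ + _] := omega1_W; apply.
rewrite (_ : setT = \bigcup_(x in X) [set y | y = x \/ lt y x]).
  by apply: bigcup_countable => // x _; exact: omega1_countable_le.
apply/seteqP; split=> // z _; apply: contrapT => nz; apply: nb; exists z => x Xx.
have [//|zx] := omega1_total x z; case: nz; exists x => //=.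
by case: zx => [->|]; [left|right].
Qed.

Lemma omega1_bound2 x y : exists z, lt x z /\ lt y z.
Proof.
have [|z z_gt] := @countable_bounded ([set x] `|` [set y]).
  by rewrite -bigcup2E; apply: bigcup_countable => // -[|[|i]] _ /=.
by exists z; split; apply: z_gt; [left|right].
Qed.

Lemma omega1_inhabited : [set: W] !=set0.
Proof.
by apply/set0P/eqP => W0; have [_ _ + _] := omega1_W; rewrite W0; exact.
Qed.

Lemma countable_sup (X : set W) : countable X ->
  exists2 d, (forall x, X x -> x = d \/ lt x d)
           & (forall y, lt y d -> exists2 x, X x & lt y x).
Proof.
move=> /countable_bounded[z zX].
have [|d dX dmin] :=
    @omega1_least [set d | forall x, X x -> x = d \/ lt x d].
  by exists z => x /zX; right.
exists d => // y yd; apply: contrapT => nx.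
have [|yd'|dy] := dmin y; last 2 first.
- by rewrite yd' in yd; exact: omega1_irr yd.
- exact: omega1_asym dy yd.
move=> x Xx; have [|[]] := omega1_total x y; [by right|by left|].
by move=> yx; case: nx; exists x.
Qed.

Definition below (d : W) (s : seq W) : Prop :=
  foldr (fun x Q => lt x d /\ Q) True s.

(** Finite sequences as arguments let one notion serve both for interleaving two clubs and for trees
    of conditions. *)
Definition closure_points (g : seq W -> W) : set W :=
  [set d | (exists x, lt x d) /\ forall s, below d s -> lt (g s) d].

Lemma below_trans x y s : lt x y -> below x s -> below y s.
Proof.
move=> xy; elim: s => //= z s IH [zx /IH]; split=> //; exact: omega1_trans xy.
Qed.

Lemma countable_below x : countable [set s | below x s].
Proof.
have [[x0 x0x]|nx] := pselect (exists y, lt y x); last first.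
  apply: sub_countable (countable1 [::]); apply: subset_card_le.
  by move=> [//|y s] /= [yx]; case: nx; exists y.
have [c cE] : exists c : nat -> W, range c = [set y | lt y x].
  by apply: countable_range x0x; have [_ _ _] := omega1_W; exact.
have : countable [set: seq nat] by exact: countableP.
apply: sub_countable; apply: card_le_trans (card_image_le (map c) _).
apply: subset_card_le => s; elim: s => [|y s IH] /=; first by exists [::].
move=> [yx /IH[l _ <-]].
have : range c y by rewrite cE.
by move=> [n _ <-]; exists (n :: l).
Qed.

(** A finite sequence below a limit of closure points already lies below one of them. Only countably
    many finite sequences lie below a given ordinal, so some ordinal exceeds all their values;
    iterating this [omega] times leads to a closure point. *)
Lemma club_closure_points (g : seq W -> W) : club lt (closure_points g).
Proof.
split=> [x|d [x0 x0d] lim]; last first.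
  split=> [|s sd]; first by exists x0.
  suff [y [[_ Cy] yd sy]] :
      exists y, [/\ closure_points g y, lt y d & below y s].
    exact: omega1_trans (Cy _ sy) yd.
  elim: s sd => [_|z s IH /= [zd /IH[y [Cy yd sy]]]].
    by have [y [Cy _ yd]] := lim _ x0d; exists y.
  have [zy|yz] : lt z y \/ (z = y \/ lt y z) by exact: omega1_total.
    by exists y.
  have [y' [Cy' zy' y'd]] := lim _ zd; exists y'; split=> //=; split=> //.
  apply: below_trans sy; case: yz => [<-//|yz]; exact: omega1_trans zy'.
have stepP z : exists z', lt z z' /\ forall s, below z s -> lt (g s) z'.
  have cz : countable ([set z] `|` g @` [set s | below z s]).
    rewrite -bigcup2E; apply: bigcup_countable => // -[|[|i]] _ //=.
    exact: sub_countable (card_image_le _ _) (countable_below z).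
  have [z' z'P] := countable_bounded cz; exists z'; split=> [|s zs].
    by apply: z'P; left.
  by apply: z'P; right; exists s.
have [step {}stepP] := choice stepP.
pose u n := iter n step x.
have uS n : lt (u n) (u n.+1) by have [] := stepP (u n).
have [d dub dlub] : exists2 d, (forall n, lt (u n) d)
                    & (forall y, lt y d -> exists n, lt y (u n)).
  have [|d dub dlub] := @countable_sup (range u).
    exact: sub_countable (card_image_le _ _) _.
  exists d => [n|y /dlub[_ [n _ <-]]]; last by exists n.
  have [|<-//|] := dub (u n.+1); first by exists n.+1.
  exact: omega1_trans.
exists d; last exact: (dub 0).
split=> [|s sd]; first by exists x; exact: (dub 0).
suff [n sn] : exists n, below (u n) s.
  by apply: omega1_trans (dub n.+1); have [_] := stepP (u n); exact.
elim: s sd => [_|y s IH /= [yd /IH[n sn]]]; first by exists 0.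
have [m ym] := dlub _ yd.
have uD k n' : u n' = u (n' + k) \/ lt (u n') (u (n' + k)).
  elim: k => [|k [e|uk]]; first by left; rewrite addn0.
    by right; rewrite addnS; have := uS (n' + k); rewrite -e.
  by right; rewrite addnS; exact: omega1_trans (uS _).
exists (m + n); split.
  by case: (uD n m) => [<-//|]; exact: omega1_trans.
by rewrite addnC; case: (uD m n) => [<-//|/below_trans]; exact.
Qed.

(** A closure point of the map that jumps first into [D] and then into [E] is a limit of both. *)
Lemma clubI_nonempty (D E : set W) : club lt D -> club lt E -> D `&` E !=set0.
Proof.
move=> [Du Dc] [Eu Ec].
have /choice[nD nDP] x : exists y, D y /\ lt x y by have [y] := Du x; exists y.
have /choice[nE nEP] x : exists y, E y /\ lt x y by have [y] := Eu x; exists y.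
have [W0 _] := omega1_inhabited.
pose g s := nE (nD (head W0 s)).
have [d [dpos dg] _] := (club_closure_points g).1 W0.
have dlim x : lt x d -> [/\ lt x (nD x), lt (nD x) d, lt (nD x) (nE (nD x))
                         & lt (nE (nD x)) d].
  move=> xd; have [[_ xD] [_ DE]] := (nDP x, nEP (nD x)).
  have Ed : lt (nE (nD x)) d by exact: (dg [:: x]).
  by split=> //; exact: omega1_trans Ed.
exists d; split; [apply: Dc|apply: Ec] => // x /dlim[xD Dd DE Ed].
  by exists (nD x); split=> //; have [] := nDP x.
exists (nE (nD x)); split=> //; first by have [] := nEP (nD x).
exact: omega1_trans DE.
Qed.

End Omega1.

(** * The forcing that shoots a club through the complement of [A] *)

Lemma fmem_mono (P : forcing) (X : Type) (x : X) (tau : name P X) (p q : P) :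
  fle q p -> fmem x tau p -> fmem x tau q.
Proof. by move=> qp px r rq; apply: px; exact: fle_trans qp. Qed.

Section Conditions.
Variables (W : Type) (lt : W -> W -> Prop) (omega1_W : is_omega1 lt).

Definition is_max (p : set W) (m : W) : Prop :=
  p m /\ forall x, p x -> x = m \/ lt x m.

Definition shooting_cond (A p : set W) : Prop :=
  [/\ closed_in lt p, exists m, is_max p m & forall x, p x -> ~ A x].

Definition end_ext (p q : set W) : Prop :=
  p `<=` q /\ forall x y, q x -> p y -> lt x y -> p x.

Lemma end_ext_refl p : end_ext p p.
Proof. by split. Qed.

Lemma end_ext_trans p q r : end_ext p q -> end_ext q r -> end_ext p r.
Proof.
move=> [pq qp] [qr rq]; split=> [x /pq /qr//|x y rx py xy].
by apply: (qp x y) => //; apply: (rq x y) => //; exact: pq.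
Qed.

Lemma countable_shooting_cond A p : shooting_cond A p -> countable p.
Proof.
move=> [_ [m [_ pm]] _].
by apply: sub_countable (omega1_countable_le omega1_W m); exact: subset_card_le.
Qed.

(** A member of [M] contains every point of [r] below any of its own points. So a limit point of [r]
    below [d] is a limit point of a single member. *)
Lemma shooting_cond_limit (A : set W) (M : set (set W)) (d : W) :
  (forall p, M p -> shooting_cond A p) ->
  (forall p q, M p -> M q -> end_ext p q \/ end_ext q p) ->
  (forall p x, M p -> p x -> lt x d) ->
  (forall y, lt y d -> exists p, exists2 x, M p /\ p x & lt y x) ->
  ~ A d ->
  let r := (\bigcup_(p in M) p) `|` [set d] in
  shooting_cond A r /\ forall p, M p -> end_ext p r.
Proof.
move=> condM chainM ltd supd nAd r.
have r_le x : r x -> x = d \/ lt x d.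
  by move=> [[p Mp px]|]; [right; exact: ltd px|left].
have rp p x y : M p -> r x -> p y -> lt x y -> p x.
  move=> Mp [[q Mq qx]|->] py xy.
    by have [[_ e]|[s _]] := chainM _ _ Mp Mq; [exact: e py xy|exact: s].
  by case: (omega1_asym omega1_W (ltd _ _ Mp py) xy).
split; last first.
  by move=> p Mp; split=> [x px|x y]; [left; exists p|exact: rp].
split; last 2 first.
- exists d; split=> //; by right.
- by move=> x [[p /condM[_ _ +] px]|->//]; exact.
move=> e e0 lim.
have [ed|[->|de]] := omega1_total omega1_W e d; last 2 first.
- by right.
- have [y [ry dy ye]] := lim _ de.
  have [yd|yd] := r_le _ ry.
    by rewrite yd in dy; case: (omega1_irr omega1_W dy).
  by case: (omega1_asym omega1_W dy yd).
have [p [x [Mp px] ex]] := supd _ ed.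
left; exists p => //; have [pcl _ _] := condM _ Mp; apply: pcl => // z ze.
have [y [ry zy ye]] := lim _ ze; exists y; split=> //.
exact: (rp p y x) (omega1_trans omega1_W ye ex).
Qed.

Lemma shooting_cond_add (A p : set W) (b : W) :
  shooting_cond A p -> ~ A b -> (forall x, p x -> lt x b) ->
  shooting_cond A (p `|` [set b]) /\ end_ext p (p `|` [set b]).
Proof.
move=> [pcl [m [pm mmax]] pA] nAb pb.
split; last first.
  split=> [x|x y [//|->] /pb yb by_]; first by left.
  by case: (omega1_asym omega1_W yb by_).
split; last 2 first.
- by exists b; split=> [|x [/pb|->]]; [right|right|left].
- by move=> x [/pA|->].
move=> e e0 lim.
have [be|nbe] := pselect (lt b e).
  have [z [[/pb zb|->] bz _]] := lim _ be.
    by case: (omega1_asym omega1_W zb bz).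
  by case: (omega1_irr omega1_W bz).
left; apply: pcl => // x /lim[y [[py|yb] xy ye]]; first by exists y.
by rewrite yb in ye.
Qed.

Variable A : set W.
Hypothesis coA : stationary lt (~` A).

Lemma stationary_compl_unbounded x : exists2 y, ~ A y & lt x y.
Proof.
have clubx : club lt [set y | lt x y].
  split=> [y|d [z zd] lim].
    by have [u [xu yu]] := omega1_bound2 omega1_W x y; exists u.
  by have [y [/= xy _ yd]] := lim _ zd; exact: (omega1_trans omega1_W xy yd).
by have [y [nAy xy]] := coA clubx; exists y.
Qed.

Lemma shooting_cond_inhabited : exists p : {p | shooting_cond A p}, True.
Proof.
have [W0 _] := omega1_inhabited omega1_W.
have [b nAb _] := stationary_compl_unbounded W0.
suff bP : shooting_cond A [set b] by exists (exist _ _ bP).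
split; last 2 first.
- by exists b; split=> // x ->; left.
- by move=> x ->.
move=> d [x xd] lim; have [y [/= -> xb bd]] := lim _ xd.
have [z [-> bb _]] := lim _ bd; by case: (omega1_irr omega1_W bb).
Qed.

(** A stronger condition is a longer set, so [fle] takes the arguments of [end_ext] in reverse. *)
Definition club_shooting : forcing :=
  @Forcing {p | shooting_cond A p} (fun q p => end_ext (sval p) (sval q))
    (fun p => end_ext_refl (sval p))
    (fun p q r pq qr => end_ext_trans qr pq) shooting_cond_inhabited.

Lemma shooting_cond_up (p : club_shooting) (a : W) :
  exists2 q, fle q p & exists2 x, sval q x & lt a x.
Proof.
case: p => p pP; have [_ [m [pm mmax]] _] := pP.
have [u [au mu]] := omega1_bound2 omega1_W a m.
have [b nAb ub] := stationary_compl_unbounded u.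
have ab : lt a b by exact: omega1_trans au ub.
have mb : lt m b by exact: omega1_trans mu ub.
have [|qP pq] := shooting_cond_add pP nAb.
  by move=> x /mmax[->//|xm]; exact: omega1_trans mb.
by exists (exist _ _ qP) => //; exists b => //; right.
Qed.

(** The union of the generic filter, named by [C] below, is a club that misses [A]. *)
Lemma club_shooting_makes_nonstationary : makes_nonstationary club_shooting lt A.
Proof.
move=> p q _ stA.
pose C : name club_shooting W := [set xr | sval xr.2 xr.1].
have memC x (r : club_shooting) : sval r x -> fmem x C r.
  by move=> rx s sr; exists s; [exact: fle_refl|exists r].
have Cmem x (r : club_shooting) : fmem x C r ->
    exists2 s, fle s r & sval s x.
  move=> /(_ r (fle_refl r))[s sr [s' s'x ss']]; exists s => //.
  by have [+ _] := ss'; exact.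
have [|r rq [x [Ax xC]]] := stA C q (fle_refl q) _ q (fle_refl q).
  split.
    move=> x r _; have [s sr [y sy xy]] := shooting_cond_up r x.
    by exists s => //; exists y; split=> //; exact: memC.
  move=> d q1 _ d0 q2 _ lim q3 q32.
  (* Once a condition reaches beyond [d], end-extension freezes the club below [d], and closedness
     of the single set [sval r] suffices. *)
  have [r rq3 [m rm dm]] := shooting_cond_up q3 d.
  exists r => //; exists r; last exact: fle_refl.
  have [rcl _ _] := svalP r; apply: rcl => // x xd.
  have rq2 : fle r q2 by exact: fle_trans q32.
  have [s sr [y [yC [xy yd]]]] := lim x r rq2 xd r (fle_refl r).
  have [s' s's s'y] := Cmem _ _ yC.
  have [_ rs'] : fle s' r by exact: fle_trans sr.
  by exists y; split=> //; exact: (rs' _ _ s'y rm (omega1_trans omega1_W yd dm)).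
have [s sr sx] := Cmem _ _ xC.
by have [_ _ /(_ x sx)] := svalP s.
Qed.

(** A descending sequence deciding every number has a lower bound if the supremum of its maxima is
    outside [A]. To secure this, a whole tree of conditions is fixed first; stationarity of the
    complement then supplies the supremum, and with it a path. *)
Lemma club_shooting_adds_no_reals : adds_no_reals club_shooting.
Proof.
move=> p tau q _.
pose decides n (r : club_shooting) := fmem n tau r \/ fnot (fmem n tau) r.
have decides_mono n r s : fle s r -> decides n r -> decides n s.
  move=> sr [rn|rn]; [left; exact: fmem_mono rn|right=> s' s's].
  by apply: rn; exact: fle_trans sr.
have stepP (arg : nat * W * club_shooting) :
    exists r, [/\ fle r arg.2, decides arg.1.1 r
                & exists2 x, sval r x & lt arg.1.2 x].
  case: arg => -[n a] r /=.
  have [s sr sn] : exists2 s, fle s r & decides n s.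
    have [[s sr sn]|nos] := pselect (exists2 s, fle s r & fmem n tau s).
      by exists s => //; left.
    exists r; first exact: fle_refl.
    by right=> s sr sn; apply: nos; exists s.
  have [t ts ta] := shooting_cond_up s a.
  by exists t; split=> //; [exact: fle_trans sr|exact: decides_mono sn].
have [step {}stepP] := choice stepP.
(* The condition at [a :: s'] extends the one at [s'], decides the number [size s'] and reaches
   above [a]. *)
pose node := fix node (s : seq W) : club_shooting :=
  if s is a :: s' then step (size s', a, node s') else q.
have topP (r : club_shooting) : exists m, is_max (sval r) m.
  by have [] := svalP r.
have [top {}topP] := choice topP.
(* A closure point of [top \o node] outside [A] is the supremum of the tops of
   a descending sequence of nodes, so the sequence has a lower bound. *)
have [d [nAd [[x0 x0d] dcl]]] :=
  coA (club_closure_points omega1_W (top \o node)).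
have [e eE] : exists e : nat -> W, range e = [set y | lt y d].
  by apply: countable_range x0d; have [_ _ _] := omega1_W; exact.
(* Along this path the maxima stay below the closure point [d], and pass every ordinal below [d], as
   [e] lists them all. *)
pose s n := iteri n (fun k l => e k :: l) [::].
have size_s n : size (s n) = n by elim: n => //= n ->.
have s_below n : below lt d (s n).
  elim: n => //= n IH; split=> //.
  by rewrite -[lt _ _]/([set y | lt y d] (e n)) -eE; exists n.
pose Q n := node (s n).
have QS n : [/\ fle (Q n.+1) (Q n), decides n (Q n.+1)
              & exists2 x, sval (Q n.+1) x & lt (e n) x].
  have [QQ Qn Qe] := stepP (size (s n), e n, Q n); split=> //.
  by have : decides (size (s n)) (Q n.+1) := Qn; rewrite size_s.
have Q_le m k : fle (Q (m + k)) (Q m).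
  elim: k => [|k IH]; first by rewrite addn0; exact: fle_refl.
  by rewrite addnS; have [QQ _ _] := QS (m + k); exact: fle_trans IH.
have [||||//|rP rQ] := @shooting_cond_limit A (range (sval \o Q)) d.
- by move=> _ [n _ <-]; exact: svalP.
- move=> _ _ [m _ <-] [n _ <-]; have [mn|nm] := leqP m n.
    by left; rewrite -(subnKC mn); exact: Q_le.
  by right; rewrite -(subnKC (ltnW nm)); exact: Q_le.
- move=> _ x [n _ <-] /= Qx; have [_ /(_ x Qx)] := topP (Q n).
  have td : lt (top (Q n)) d by exact: dcl.
  by move=> [->//|xt]; exact: omega1_trans xt td.
- move=> y yd; have : range e y by rewrite eE.
  move=> [n _ <-]; have [_ _ [x Qx ex]] := QS n.
  by exists (sval (Q n.+1)), x => //; split=> //; exists n.+1.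
pose r : club_shooting := exist _ _ rP.
have rQn n : fle r (Q n) by apply: rQ; exists n.
exists r; first exact: (rQn 0).
(* [r] decides every number, so it forces the real to be this ground model set. *)
exists [set n | fmem n tau r] => n.
have [rn|rn] : decides n r by have [_ + _] := QS n; exact: decides_mono.
  by split=> t tr // _; exact: fmem_mono rn.
split=> t tr; last by move=> rn1; exact: fmem_mono rn1.
by move=> tn; case: (rn t tr).
Qed.

End Conditions.

(** * Canary trees and branch approximations *)

Section BranchApproximation.
Variables (W : Type) (lt : W -> W -> Prop) (omega1_W : is_omega1 lt).
Variables (T : Type) (ltT : T -> T -> Prop).

(* [O t c] stands for: [t] is in [o p], where [c] enumerates [p]. *)
Definition branch_approx (A : set W) (O : T -> (nat -> W) -> Prop) : Prop :=
  exists c0 : nat -> W, shooting_cond lt A (range c0) /\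
    forall c : nat -> W,
      shooting_cond lt A (range c) -> end_ext lt (range c0) (range c) ->
    [/\ forall d : nat -> W,
          shooting_cond lt A (range d) -> end_ext lt (range c) (range d) ->
          forall t, O t c -> O t d,
        forall t t', ~ comparable_by ltT t t' -> O t c -> ~ O t' c
      & exists d : nat -> W, [/\ shooting_cond lt A (range d),
          end_ext lt (range c) (range d) & exists t, ~ O t c /\ O t d]].

(** [O] reads off what each condition forces into a name [B] of an uncountable branch. If it stopped
    growing at [q], an injection into [nat] of the resulting ground model branch would make [B]
    countable below [q]. *)
Lemma canary_branch_approx (A : set W) : canary_tree lt ltT ->
  stationary lt A -> stationary lt (~` A) -> exists O, branch_approx A O.
Proof.
move=> [_ _ branch_countable canary] stA coA.
pose P := club_shooting omega1_W coA.
have [p _] := forcing_inhabited P.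
have [p0 _ [B [[Bchain Bmax] Bunc]]] :=
  canary A P stA (@club_shooting_adds_no_reals _ _ omega1_W _ coA)
    (@club_shooting_makes_nonstationary _ _ omega1_W _ coA) p p (fle_refl p).
have enumP (q : P) : exists c : nat -> W, range c = sval q.
  have qP := svalP q; have [_ [m [qm _]] _] := qP.
  exact: countable_range (countable_shooting_cond omega1_W qP) qm.
have [c0 c0E] := enumP p0.
(* Conditions carry a proof; a sequence that enumerates no condition is related to no [t]. *)
exists (fun t c => exists2 q : P, sval q = range c & fmem t B q).
exists c0; rewrite c0E; split; first exact: svalP.
move=> c cP p0c; pose q : P := exist _ _ cP.
have memq (r : P) t : sval r = range c -> fmem t B r -> fmem t B q.
  move=> rc; apply: fmem_mono.
  by rewrite /fle /= rc; exact: end_ext_refl.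
split.
- move=> d dP cd t [r rc /(memq _ _ rc) tq].
  by exists (exist _ _ dP) => //; exact: fmem_mono tq.
- move=> t t' ntt' [r rc /(memq _ _ rc) tq] [r' r'c /(memq _ _ r'c) t'q].
  by apply: ntt'; exact: (Bchain t t' q p0c (conj tq t'q)).
apply: contrapT => nogrow.
have stable (r : P) t : fle r q -> fmem t B r -> fmem t B q.
  move=> rq tr; apply: contrapT => ntq; apply: nogrow.
  have [d dE] := enumP r; exists d; rewrite dE; split=> //; first exact: svalP.
  exists t; split; last by exists r.
  by move=> [r' r'c /(memq _ _ r'c)].
have brB : branch ltT [set t | fmem t B q].
  split=> [x y xq yq|y cmp]; first exact: (Bchain x y q p0c (conj xq yq)).
  by apply: (Bmax y q p0c) => x r rq xr; apply: cmp; exact: stable xr.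
have /countable_injP[f finj] := branch_countable _ brB.
apply: (Bunc q p0c) => r rq; exists r; first exact: fle_refl.
(* The canonical name of the graph of [f]: its pairs come with every condition. *)
exists [set xs | fmem xs.1.1 B q /\ f xs.1.1 = xs.1.2].
have memf x n (s : P) :
    fmem (x, n) [set xs : T * nat * P | fmem xs.1.1 B q /\ f xs.1.1 = xs.1.2] s ->
    fmem x B q /\ f x = n.
  by move=> /(_ s (fle_refl s))[_ _ [_ //]].
split=> [x s sr xs|].
  move=> s' s's; exists s'; first exact: fle_refl.
  exists (f x) => s2 _; exists s2; first exact: fle_refl.
  exists s2; last exact: fle_refl.
  by split=> //=; apply: stable xs; exact: fle_trans rq.
split=> [x m n s sr [/memf[_ <-] /memf[_ <-]]//|x y n s sr].
by move=> [/memf[xq <-] /memf[yq /esym fxy]]; apply: finj => //; exact/mem_set.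
Qed.

(** Zorn's lemma replaces the recursion along [omega_1]. Let [M] be a maximal chain of conditions
    with maximum in [D] along which [o] grows strictly. Countable chains have strict upper bounds,
    [M] has none. But the union of [o] over [M] lies in a branch, hence is countable, and countably
    many members witnessing it are cofinal in [M]. *)
Lemma branch_approx_stationary (A : set W) (O : T -> (nat -> W) -> Prop) :
  (forall B : set T, branch ltT B -> countable B) ->
  branch_approx A O -> stationary lt A.
Proof.
move=> branch_countable [c0 [p0P apx]] D clubD.
apply: contrapT => nAD.
have DA x : D x -> ~ A x by move=> Dx Ax; apply: nAD; exists x.
set p0 := range c0 in p0P apx.
(* Sets that are not conditions get the dummy enumeration [c0]. *)
have enumP p : exists c : nat -> W, shooting_cond lt A p -> range c = p.
  have [pP|np] := pselect (shooting_cond lt A p); last by exists c0.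
  have [_ [m [pm _]] _] := pP.
  have [c cE] := countable_range (countable_shooting_cond omega1_W pP) pm.
  by exists c.
have [enum {}enumP] := choice enumP.
pose o p t := O t (enum p).
have o_mono p q t : shooting_cond lt A p -> end_ext lt p0 p ->
    shooting_cond lt A q -> end_ext lt p q -> o p t -> o q t.
  move=> pP p0p qP pq; have [||+ _ _] := apx (enum p); rewrite enumP //.
  by apply; rewrite enumP.
have o_chain p t t' : shooting_cond lt A p -> end_ext lt p0 p ->
    o p t -> o p t' -> comparable_by ltT t t'.
  move=> pP p0p; have [||_ + _] := apx (enum p); rewrite ?enumP // => ch ot ot'.
  by apply: contrapT => /ch /(_ ot).
have o_grow p : shooting_cond lt A p -> end_ext lt p0 p ->
    exists q, [/\ shooting_cond lt A q, end_ext lt p q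
                & exists t, ~ o p t /\ o q t].
  move=> pP p0p; have [||_ _] := apx (enum p); rewrite ?enumP //.
  move=> [d [dP pd [t [npt dt]]]]; exists (range d); split=> //; exists t.
  split=> //; have [||+ _ _] := apx d => //; first exact: end_ext_trans pd.
  by apply; rewrite ?enumP //; exact: end_ext_refl.
(* Maxima in [D] make the supremum of a chain without last element a limit of [D], hence an ordinal
   outside [A]. *)
pose node p := [/\ shooting_cond lt A p, end_ext lt p0 p
                 & exists2 m, is_max lt p m & D m].
pose R p q := end_ext lt p q /\ exists t, ~ o p t /\ o q t.
have R_irr p : ~ R p p by move=> [_ [t []]].
have addD p : shooting_cond lt A p -> end_ext lt p0 p ->
    exists2 q, node q & end_ext lt p q.
  move=> pP p0p; have [_ [m [pm mmax]] _] := pP.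
  have [b Db mb] := clubD.1 m.
  have [|qP pq] := shooting_cond_add omega1_W pP (DA _ Db).
    by move=> x /mmax[->//|xm]; exact: omega1_trans mb.
  exists (p `|` [set b]) => //; split=> //; first exact: end_ext_trans pq.
  exists b => //; split=> [|x [/mmax[->|xm]|->]]; [by right|by right| |by left].
  by right; exact: omega1_trans mb.
have R_trans p q r : node p -> node q -> node r -> R p q ->
    end_ext lt q r -> R p r.
  move=> [pP p0p _] [qP p0q _] [rP _ _] [pq [t [npt qt]]] qr.
  split; first exact: end_ext_trans qr.
  by exists t; split=> //; exact: o_mono qt.
have step p : node p -> exists2 q, node q & R p q.
  move=> [pP p0p _]; have [q [qP pq [t [npt qt]]]] := o_grow _ pP p0p.
  have p0q : end_ext lt p0 q by exact: end_ext_trans pq.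
  have [r [rP p0r rD] qr] := addD _ qP p0q.
  exists r => //; split; first exact: end_ext_trans qr.
  by exists t; split=> //; exact: o_mono qt.
pose chain (M : set (set W)) := M `<=` node /\
  forall p q, M p -> M q -> p = q \/ (R p q \/ R q p).
have ubound N : chain N -> countable N ->
    exists2 q, node q & forall p, N p -> R p q.
  move=> [Nnode Nchain] cN.
  have [[p1 Np1]|N0] := pselect (N !=set0); last first.
    have [q qnode _] := addD _ p0P (end_ext_refl lt p0).
    by exists q => // p Np; case: N0; exists p.
  pose U := \bigcup_(p in N) p.
  have cU : countable U.
    apply: bigcup_countable => // p /Nnode[pP _ _].
    exact: countable_shooting_cond pP.
  have [d Ud supd] := countable_sup omega1_W cU.
  (* A member that contains the supremum is the last one; otherwise the union of [N] receives [d] as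
     its maximum. *)
  have [[p Np pd]|nod] := pselect (exists2 p, N p & p d).
    have [q qnode pq] := step _ (Nnode _ Np); exists q => // p' Np'.
    have [->//|[pp'|p'p]] := Nchain _ _ Np' Np.
      by apply: R_trans pp' pq.1 => //; exact: Nnode.
    suff e : p = p' by rewrite e in p'p; case: (R_irr _ p'p).
    have [[sub ext] _] := p'p; apply/seteqP; split=> // x p'x.
    have [->//|xd] : x = d \/ lt x d by apply: Ud; exists p'.
    exact: ext pd xd.
  have ltd p x : N p -> p x -> lt x d.
    move=> Np px; have [xd|//] : x = d \/ lt x d by apply: Ud; exists p.
    by case: nod; exists p => //; rewrite -xd.
  have Dd : D d.
    apply: clubD.2.
      have [_ _ [m [p1m _] _]] := Nnode _ Np1.
      by exists m; exact: ltd p1m.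
    move=> y /supd[x [p Np px] yx].
    have [_ _ [m [pm mmax] Dm]] := Nnode _ Np; exists m; split=> //.
      by have [<-//|xm] := mmax _ px; exact: omega1_trans xm.
    exact: ltd pm.
  have [|||||rP Nr] := @shooting_cond_limit _ _ omega1_W A N d.
  - by move=> p /Nnode[].
  - move=> p q Np Nq; have [->|[[pq _]|[qp _]]] := Nchain _ _ Np Nq.
    + by left; exact: end_ext_refl.
    + by left.
    + by right.
  - exact: ltd.
  - by move=> y /supd[x [p Np px] yx]; exists p, x.
  - exact: DA.
  set r := (_ `|` _) in rP Nr.
  have rnode : node r.
    split=> //.
      by have [_ p0p1 _] := Nnode _ Np1; exact: end_ext_trans (Nr _ Np1).
    exists d => //; split=> [|x [[p Np px]|->]]; [by right| |by left].
    by right; exact: ltd px.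
  (* So far [r] only end-extends the members of [N]; a further step makes [o] grow strictly. *)
  have [s snode rs] := step _ rnode; exists s => // p Np.
  have [pP p0p _] := Nnode _ Np; have [rs1 [t [nrt st]]] := rs.
  split; first exact: end_ext_trans (Nr _ Np) rs1.
  exists t; split=> // pt; apply: nrt; apply: o_mono pt => //; exact: Nr.
have [F Fch Ftot|M [[Mnode Mchain] maxM]] := @Zorn_bigcup _ chain.
  split=> [p [X FX Xp]|p q [X FX Xp] [Y FY Yq]].
    by have [+ _] := Fch _ FX; exact.
  have [XY|YX] := Ftot _ _ FX FY.
    by have [_ +] := Fch _ FY; apply=> //; exact: XY.
  by have [_ +] := Fch _ FX; apply=> //; exact: YX.
have nobound : ~ exists2 q, node q & forall p, M p -> R p q.
  move=> [q qnode Mq]; apply: (maxM (M `|` [set q])).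
    split=> [p|/(_ q)]; first by left.
    by move=> /(_ (or_intror erefl)) /Mq /R_irr.
  split=> [p [/Mnode//|->//]|p p' [Mp|->] [Mp'|->]].
  - exact: Mchain.
  - by right; left; exact: Mq.
  - by right; right; exact: Mq.
  - by left.
have Mgrow p : M p -> exists2 q, M q & R p q.
  move=> Mp; apply: contrapT => nq; apply: nobound.
  have [q qnode pq] := step _ (Mnode _ Mp); exists q => // p' Mp'.
  have [->//|[p'p|pp']] := Mchain _ _ Mp' Mp.
    by apply: R_trans p'p pq.1 => //; exact: Mnode.
  by case: nq; exists p'.
pose B0 := [set t | exists2 p, M p & o p t].
have B0chain t t' : B0 t -> B0 t' -> comparable_by ltT t t'.
  move=> [p Mp pt] [q Mq qt].
  have [pP p0p _] := Mnode _ Mp; have [qP p0q _] := Mnode _ Mq.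
  have [pq|[[pq _]|[qp _]]] := Mchain _ _ Mp Mq.
  - by apply: (o_chain q) => //; rewrite -pq.
  - by apply: (o_chain q) => //; exact: o_mono pt.
  - by apply: (o_chain p) => //; exact: o_mono qt.
have [B B0B /branch_countable cB] := chain_sub_branch B0chain.
have cB0 : countable B0 by apply: sub_countable cB; exact: subset_card_le.
(* [h t] will be a member of [M] at which [t] has appeared; [p0] is a dummy outside [B0]. *)
have hP t : exists p, B0 t -> M p /\ o p t.
  by have [[p Mp pt]|nt] := pselect (B0 t); [exists p|exists p0].
have [h {}hP] := choice hP.
have [|| q qnode Nq] := ubound (h @` B0).
- split=> [_ [t /hP[Mp _] <-]|_ _ [t /hP[Mp _] <-] [t' /hP[Mp' _] <-]].
    exact: Mnode.
  exact: Mchain.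
- exact: sub_countable (card_image_le _ _) cB0.
apply: nobound; exists q => // p Mp.
(* As [t] is not in [o p], monotonicity puts its witness [h t] beyond [p], and [q] is beyond
   [h t]. *)
have [q' Mq' [pq' [t [npt q't]]]] := Mgrow _ Mp.
have B0t : B0 t by exists q'.
have [Mh ht] := hP _ B0t.
have hq : R (h t) q by apply: Nq; exists t.
have [pP p0p _] := Mnode _ Mp; have [hPt p0h _] := Mnode _ Mh.
have [e|[ph|[hp _]]] := Mchain _ _ Mp Mh.
- by rewrite -e in ht.
- by apply: R_trans ph hq.1 => //; exact: Mnode.
- by case: npt; exact: o_mono ht.
Qed.

End BranchApproximation.

(** * Definability in [L_{omega_2 omega_1}] *)

Section Expressibility.
Variables (W : Type) (lt : W -> W -> Prop).
Hypothesis nat_leW : [set: nat] #<= [set: W].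
Variables (T : Type) (T_leW : [set: T] #<= [set: W]).

(* [None] denotes a club contained in [A]; [Some t] holds of the sequences
   enumerating a condition [p] with [t] in [o p]. *)
Definition approx_vocabulary : vocabulary :=
  @Vocabulary (option T) (fun s => if s is Some _ then None else Some 1).

Definition approx_interp (K : set W) (O : T -> (nat -> W) -> Prop) :
    interp_on approx_vocabulary W :=
  fun s => match s return (places (@arity approx_vocabulary s) -> W) -> Prop with
           | Some t => O t
           | None => fun u => K (u ord0)
           end.

(** One formula has to serve all [A] and [J]. Working with its meaning lets formulas be built by
    following the shape of the statements to be expressed. *)
Definition expressible (X : Type)
    (Q : set W -> interp_on approx_vocabulary W -> (X -> W) -> Prop) : Prop :=
  exists f : formula W (expanded_vocabulary lt_pred_vocabulary approx_vocabulary) X,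
    forall A J a,
      @sat W _ (@expansion _ approx_vocabulary (lt_pred_structure lt A) J) X f a
      <-> Q A J a.

Lemma expressible_eq X (x y : X) : expressible (fun _ _ a => a x = a y).
Proof. by exists (Feq _ _ x y). Qed.

Lemma expressible_lt X (x y : X) : expressible (fun _ _ a => lt (a x) (a y)).
Proof.
exists (@Frel W (expanded_vocabulary lt_pred_vocabulary approx_vocabulary) X
  (inl Sym_lt) (fun i : 'I_2 => if val i == 0 then x else y)).
by [].
Qed.

Lemma expressible_A X (x : X) : expressible (fun A _ a => A (a x)).
Proof.
by exists (@Frel W (expanded_vocabulary lt_pred_vocabulary approx_vocabulary) X
  (inl Sym_A) (fun _ : 'I_1 => x)).
Qed.

Lemma expressible_unary X (x : X) :
  expressible (fun _ J a => J None (fun _ => a x)).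
Proof.
by exists (@Frel W (expanded_vocabulary lt_pred_vocabulary approx_vocabulary) X
  (inr None) (fun _ : 'I_1 => x)).
Qed.

Lemma expressible_approx X (t : T) (v : nat -> X) :
  expressible (fun _ J a => J (Some t) (fun n => a (v n))).
Proof.
by exists (@Frel W (expanded_vocabulary lt_pred_vocabulary approx_vocabulary) X
  (inr (Some t)) v).
Qed.

Lemma expressible_not X Q : @expressible X Q ->
  expressible (fun A J a => ~ Q A J a).
Proof. by move=> [f fP]; exists (Fnot f) => A J a /=; rewrite fP. Qed.

Lemma expressible_conj X I (Q : I -> _) : [set: I] #<= [set: W] ->
  (forall i, @expressible X (Q i)) ->
  expressible (fun A J a => forall i, Q i A J a).
Proof.
move=> leI /choice[f fP]; exists (Fconj leI f) => A J a /=.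
by split=> + i => /(_ i) /fP.
Qed.

Lemma expressible_disj X I (Q : I -> _) : [set: I] #<= [set: W] ->
  (forall i, @expressible X (Q i)) ->
  expressible (fun A J a => exists i, Q i A J a).
Proof.
move=> leI /choice[f fP]; exists (Fdisj leI f) => A J a /=.
by split=> -[i] /fP; exists i.
Qed.

Lemma bool_leW : [set: bool] #<= [set: W].
Proof. exact: card_le_trans (countableP _) nat_leW. Qed.

Lemma expressible_and X Q Q' : @expressible X Q -> @expressible X Q' ->
  expressible (fun A J a => Q A J a /\ Q' A J a).
Proof.
move=> [f fP] [f' fP']; exists (Fconj bool_leW (fun b => if b then f else f')).
move=> A J a /=; split=> [H|[/fP ? /fP' ?] []//].
by split; [exact/fP/(H true)|exact/fP'/(H false)].
Qed.

Lemma expressible_or X Q Q' : @expressible X Q -> @expressible X Q' ->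
  expressible (fun A J a => Q A J a \/ Q' A J a).
Proof.
move=> [f fP] [f' fP']; exists (Fdisj bool_leW (fun b => if b then f else f')).
move=> A J a /=; split=> [[[] /=]|[/fP|/fP']]; [by move/fP; left|by move/fP'; right| |].
  by exists true.
by exists false.
Qed.

Lemma expressible_ext X Q Q' : (forall A J a, Q A J a <-> Q' A J a) ->
  @expressible X Q -> @expressible X Q'.
Proof. by move=> QQ' [f fP]; exists f => A J a; rewrite fP. Qed.

Lemma expressible_and3 X Q Q' Q'' :
  @expressible X Q -> @expressible X Q' -> @expressible X Q'' ->
  expressible (fun A J a => [/\ Q A J a, Q' A J a & Q'' A J a]).
Proof.
move=> eQ eQ' eQ''; apply: expressible_ext (expressible_and eQ (expressible_and eQ' eQ'')).
by move=> A J a; split=> [[? []]|[]].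
Qed.

Lemma expressible_imp X Q Q' : @expressible X Q -> @expressible X Q' ->
  expressible (fun A J a => Q A J a -> Q' A J a).
Proof.
move=> eQ eQ'; apply: expressible_ext (expressible_or (expressible_not eQ) eQ').
move=> A J a; split=> [[]//|QQ'].
by have [/QQ'|] := pselect (Q A J a); [right|left].
Qed.

(** [C] does not depend on the structure: its truth value selects between [Q] and the tautology
    [Q -> Q]. *)
Lemma expressible_cst_imp X (C : Prop) Q : @expressible X Q ->
  expressible (fun A J a => C -> Q A J a).
Proof.
have [c|nc] := pselect C.
  by apply: expressible_ext => A J a; split=> // /(_ c).
move=> eQ; apply: expressible_ext (expressible_imp eQ eQ).
by move=> A J a; split.
Qed.

Lemma expressible_forall X I Q : countable [set: I] ->
  @expressible (X + I) (fun A J e => Q A J (fun x => e (inl x)) (fun i => e (inr i))) ->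
  expressible (fun A J a => forall b : I -> W, Q A J a b).
Proof.
move=> cI [f fP]; exists (Fforall cI f) => A J a /=; split=> H b.
  exact/(fP A J (extend_env a b))/H.
by apply/fP; exact: H.
Qed.

Lemma expressible_exists X I Q : countable [set: I] ->
  @expressible (X + I) (fun A J e => Q A J (fun x => e (inl x)) (fun i => e (inr i))) ->
  expressible (fun A J a => exists b : I -> W, Q A J a b).
Proof.
move=> cI [f fP]; exists (Fexists cI f) => A J a /=; split=> -[b H]; exists b.
  exact/(fP A J (extend_env a b)).
exact/fP.
Qed.

Lemma expressible_forall1 X Q :
  @expressible (X + unit) (fun A J e => Q A J (fun x => e (inl x)) (e (inr tt))) ->
  expressible (fun A J a => forall x : W, Q A J a x).
Proof.
move=> eQ; have := @expressible_forall X unit (fun A J a b => Q A J a (b tt)).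
move=> /(_ (countableP _) eQ); apply: expressible_ext => A J a.
by split=> H x; [exact: (H (fun=> x))|exact: H].
Qed.

Lemma expressible_exists1 X Q :
  @expressible (X + unit) (fun A J e => Q A J (fun x => e (inl x)) (e (inr tt))) ->
  expressible (fun A J a => exists x : W, Q A J a x).
Proof.
move=> eQ; have := @expressible_exists X unit (fun A J a b => Q A J a (b tt)).
move=> /(_ (countableP _) eQ); apply: expressible_ext => A J a.
by split=> -[x]; [exists (x tt)|exists (fun=> x)].
Qed.

Lemma expressible_range X (v : nat -> X) (y : X) :
  expressible (fun _ _ a => range (fun n => a (v n)) (a y)).
Proof.
have := @expressible_disj X nat (fun n _ _ a => a (v n) = a y) nat_leW
  (fun n => expressible_eq (v n) y).
by apply: expressible_ext => A J a; split=> [[n e]|[n _ e]]; exists n.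
Qed.

(** Each quantifier enlarges the type of free variables, so membership in [C] has to be expressible
    after any renaming [u]. *)
Lemma expressible_closed_in X (C : _ -> _ -> _ -> set W) :
  (forall Y (u : X -> Y) (y : Y),
     expressible (fun A J e => C A J (fun x => e (u x)) (e y))) ->
  expressible (fun A J a => closed_in lt (C A J a)).
Proof.
move=> eC; apply: expressible_forall1; apply: expressible_imp.
  by apply: expressible_exists1; exact: expressible_lt.
apply: expressible_imp; last exact: (eC _ inl).
apply: expressible_forall1; apply: expressible_imp; first exact: expressible_lt.
apply: expressible_exists1; apply: expressible_and3.
- exact: (eC _ (fun x => inl (inl (inl x)))).
- exact: expressible_lt.
- exact: expressible_lt.
Qed.

Lemma expressible_shooting_cond X (v : nat -> X) :
  expressible (fun A _ a => shooting_cond lt A (range (fun n => a (v n)))).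
Proof.
apply: expressible_and3.
- apply: (@expressible_closed_in X (fun _ _ a => range (fun n => a (v n)))) => Y u y.
  exact: (expressible_range (fun n => u (v n))).
- apply: expressible_exists1; apply: expressible_and.
    exact: (expressible_range (fun n => inl (v n))).
  apply: expressible_forall1; apply: expressible_imp.
    exact: (expressible_range (fun n => inl (inl (v n)))).
  by apply: expressible_or; [exact: expressible_eq|exact: expressible_lt].
- apply: expressible_forall1; apply: expressible_imp.
    exact: (expressible_range (fun n => inl (v n))).
  by apply: expressible_not; exact: expressible_A.
Qed.

Lemma expressible_end_ext X (v w : nat -> X) :
  expressible (fun _ _ a =>
    end_ext lt (range (fun n => a (v n))) (range (fun n => a (w n)))).
Proof.
apply: expressible_and; apply: expressible_forall1.
  apply: expressible_imp; first exact: (expressible_range (fun n => inl (v n))).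
  exact: (expressible_range (fun n => inl (w n))).
apply: expressible_forall1; apply: expressible_imp.
  exact: (expressible_range (fun n => inl (inl (w n)))).
apply: expressible_imp.
  exact: (expressible_range (fun n => inl (inl (v n)))).
apply: expressible_imp; first exact: expressible_lt.
exact: (expressible_range (fun n => inl (inl (v n)))).
Qed.

Lemma expressible_club_sub X :
  @expressible X (fun A J _ => club lt [set x | J None (fun _ => x)] /\
                               [set x | J None (fun _ => x)] `<=` A).
Proof.
apply: expressible_and.
  apply: expressible_and.
    apply: expressible_forall1.
    apply: (@expressible_ext _ (fun A J e => exists y,
      J None (fun _ => y) /\ lt (e (inr tt)) y)).
      by move=> A J e; split=> [[y []]|[y]]; exists y.
    apply: expressible_exists1; apply: expressible_and.
      exact: expressible_unary.
    exact: expressible_lt.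
  apply: (@expressible_closed_in X (fun _ J _ => [set x | J None (fun _ => x)])).
  by move=> Y u y; exact: expressible_unary.
apply: expressible_forall1; apply: expressible_imp; first exact: expressible_unary.
exact: expressible_A.
Qed.

(** Quantifiers over conditions become blocks of [omega] variables. The tree lies outside the
    structure: quantifiers over [T] become conjunctions and disjunctions of size at most
    [omega_1]. *)
Lemma expressible_branch_approx X (ltT : T -> T -> Prop) :
  @expressible X (fun A J _ => branch_approx lt ltT A (fun t => J (Some t))).
Proof.
have cN : countable [set: nat] by exact: countableP.
apply: expressible_exists => //; apply: expressible_and.
  exact: (expressible_shooting_cond inr).
apply: expressible_forall => //; apply: expressible_imp.
  exact: (expressible_shooting_cond inr).
apply: expressible_imp.
  exact: (expressible_end_ext (fun n => inl (inr n)) inr).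
apply: expressible_and3.
- apply: expressible_forall => //; apply: expressible_imp.
    exact: (expressible_shooting_cond inr).
  apply: expressible_imp.
    exact: (expressible_end_ext (fun n => inl (inr n)) inr).
  apply: expressible_conj => // t; apply: expressible_imp.
    exact: (expressible_approx t (fun n => inl (inr n))).
  exact: (expressible_approx t inr).
- apply: expressible_conj => // t; apply: expressible_conj => // t'.
  apply: expressible_cst_imp; apply: expressible_imp.
    exact: (expressible_approx t inr).
  by apply: expressible_not; exact: (expressible_approx t' inr).
- apply: expressible_exists => //; apply: expressible_and3.
  + exact: (expressible_shooting_cond inr).
  + exact: (expressible_end_ext (fun n => inl (inr n)) inr).
  + apply: expressible_disj => // t; apply: expressible_and.
      apply: expressible_not.
      exact: (expressible_approx t (fun n => inl (inr n))).
    exact: (expressible_approx t inr).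
Qed.

End Expressibility.

(** * Stationarity as a projective class *)

Theorem theorem5 (W : Type) (lt : W -> W -> Prop) (omega1_W : is_omega1 lt)
    (continuum_hyp : CH W)
    (canary : exists (T : Type) (ltT : T -> T -> Prop), canary_tree lt ltT) :
  exists Phi : PC W lt_pred_vocabulary,
    forall A : set W,
      PC_models (lt_pred_structure lt A) Phi <-> stationary lt A.
Proof.
have [T [ltT canaryT]] := canary.
have [_ T_le branch_countable _] := canaryT.
(* CH turns the bound [2 ^ omega] on the tree into [omega_1], the size allowed for conjunctions. *)
have T_leW : [set: T] #<= [set: W].
  by have /card_eqPle[+ _] := continuum_hyp; exact: card_le_trans.
have natW := omega1_infinite omega1_W.
have [f fP] := @expressible_or _ lt natW T _ _ _ (@expressible_club_sub _ lt natW T Empty_set)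
  (@expressible_branch_approx _ lt natW _ T_leW Empty_set ltT).
exists (MkPC f) => A; split=> [[J /fP[[clubK KA] D clubD|]]|stA].
- have [x [Kx Dx]] := clubI_nonempty omega1_W clubK clubD.
  by exists x; split=> //; exact: KA.
- exact: branch_approx_stationary.
have [[K clubK KA]|noK] := pselect (exists2 K, club lt K & K `<=` A).
  by exists (approx_interp K (fun _ : T => set0)); apply/fP; left.
(* Since [A] contains no club, its complement is stationary, as the forcing requires. *)
have [|O OP] := canary_branch_approx omega1_W canaryT stA.
  move=> C clubC; apply: contrapT => nC; apply: noK; exists C => // x Cx.
  by apply: contrapT => nAx; apply: nC; exists x.
by exists (approx_interp set0 O); apply/fP; right.
Qed.
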